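(* Let $\mathcal{A}$ be an orthogonal array $\mathrm{OA}(2,n,k)$, with symbols written as $1,2,\ldots,k$, and put $r=n-1$, where $r\ge 1$. Let $\mathcal{S}$ be the system on $\mathbb{Z}_2^{(n-1)k}\times\mathbb{Z}_{k+1}$ whose blocks (codewords) are: (1) for each $i$ with $0\le i\le r-1$, the word with ones exactly in the binary coordinates $ik+1,ik+2,\ldots,ik+k$ and $0$ in the last coordinate; and (2) for each row $(j_1,j_2,\ldots,j_n)$ of $\mathcal{A}$, the word whose ones among the first $(n-1)k$ binary coordinates are exactly in the positions $j_1,\,k+j_2,\,\ldots,\,(r-1)k+j_r$ and whose last coordinate (coordinate $rk+1$) is the letter $j_n\in\mathbb{Z}_{k+1}$. Then $\mathcal{S}$ is a mixed Steiner system $\mathrm{MS}(2,k,\mathbb{Z}_2^{(n-1)k}\times\mathbb{Z}_{k+1})$.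
   Context: An orthogonal array $\mathrm{OA}(2,n,k)$ is a $k^2\times n$ array over an alphabet of $k$ symbols such that in the projection onto any two columns each ordered pair of symbols appears exactly once. For $Q=\mathbb{Z}_{q_1}\times\cdots\times\mathbb{Z}_{q_N}$, viewed as the set of words of length $N$ whose $i$-th letter lies in $\mathbb{Z}_{q_i}$, the weight of a word is its number of nonzero coordinates, and $d(\cdot,\cdot)$ is the Hamming distance. $\mathbb{Z}_2^{m}\times\mathbb{Z}_q$ has $m$ binary coordinates (indexed $1,\dots,m$) followed by one coordinate over $\mathbb{Z}_q$. A mixed Steiner system $\mathrm{MS}(t,k,Q)$ is a pair $(Q,\mathcal{C})$, where $\mathcal{C}$ is a set of words (codewords) of $Q$ of weight $k$ such that (i) for every word $x\in Q$ of weight $t$ there is exactly one codeword $c\in\mathcal{C}$ with $d(x,c)=k-t$; and (ii) the minimum Hamming distance of $\mathcal{C}$ is $2(k-t)+1$.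
   Formalization: The formal theorem assumes in addition n = k: the row words have weight n while MS(2,k,·) requires every codeword to have weight k, so the claim as written fails for n ≠ k (for example OA(2,2,3) gives row words of weight 2). *)

(* Defs.v *)
From mathcomp Require Import all_boot all_algebra.
Set Implicit Arguments.
Unset Strict Implicit.
Unset Printing Implicit Defensive.
Import GRing.Theory.
Local Open Scope ring_scope.

(* The words of Z_{q_0} x ... x Z_{q_(N-1)}.  Meaningful when every q_i is at
   least 2, as 'Z_0 and 'Z_1 are copies of Z_2. *)
Definition word (N : nat) (q : 'I_N -> nat) : finType :=
  {dffun forall i : 'I_N, 'Z_(q i)}.

Definition weight (N : nat) (q : 'I_N -> nat) (x : word q) : nat :=
  #|[set i : 'I_N | x i != 0]|.

Definition hdist (N : nat) (q : 'I_N -> nat) (x y : word q) : nat :=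
  #|[set i : 'I_N | x i != y i]|.

Definition has_min_dist (N : nat) (q : 'I_N -> nat) (C : {set word q})
    (d : nat) : Prop :=
  (exists x y : word q, [/\ x \in C, y \in C, x != y & hdist x y = d]) /\
  (forall x y : word q, x \in C -> y \in C -> x != y -> (d <= hdist x y)%N).

(* The condition t <= k, implicit in the notion, makes the truncated
   subtraction k - t exact. *)
Definition mixed_steiner_system (t k N : nat) (q : 'I_N -> nat)
    (C : {set word q}) : Prop :=
  [/\ (t <= k)%N,
      forall c : word q, c \in C -> weight c = k,
      forall x : word q, weight x = t ->
        exists! c : word q, c \in C /\ hdist x c = (k - t)%N
    & has_min_dist C (2 * (k - t) + 1)%N].

Definition orthogonal_array2 (n k : nat) (A : 'M['I_k]_(k ^ 2, n)) : Prop :=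
  forall c1 c2 : 'I_n, c1 != c2 -> forall a b : 'I_k,
    #|[set i | (A i c1 == a) && (A i c2 == b)]| = 1%N.

(* The alphabet sizes of Z_2^m x Z_s. *)
Definition binary_plus (m s : nat) (i : 'I_m.+1) : nat :=
  if (i < m)%N then 2%N else s.
Arguments binary_plus m s i : clear implicits.

(* Below, arrays have n = r.+1 columns.  Coordinates are numbered from 0, and
   a : 'I_k stands for the symbol a + 1 of {1, ..., k}; hence the symbol a in
   column i < r marks the coordinate i * k + a, and the symbol a in the last
   column gives the nonzero letter a + 1 of Z_{k+1}. *)
Definition group_word (r k : nat) (i : 'I_r) :
    word (binary_plus (r * k) k.+1) :=
  [ffun l : 'I_(r * k).+1 =>
     if (i * k <= l < i * k + k)%N then 1 else 0].

Definition row_word (r k : nat) (j : 'I_r.+1 -> 'I_k) :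
    word (binary_plus (r * k) k.+1) :=
  [ffun l : 'I_(r * k).+1 =>
     if (l < r * k)%N then
       if [exists i : 'I_r, l == (i * k + j (widen_ord (leqnSn r) i))%N :> nat]
       then 1 else 0
     else (j ord_max).+1%:R].

(* The row words have weight r + 1 and the group words have weight k. *)
Definition oa_system (r k : nat) (A : 'M['I_k]_(k ^ 2, r.+1)) :
    {set word (binary_plus (r * k) k.+1)} :=
  [set group_word k i | i : 'I_r] :|: [set row_word (A a) | a : 'I_(k ^ 2)].

(* Main.v *)
Require Import Defs.
From mathcomp Require Import all_boot all_algebra.
From mathcomp Require Import zify.

(* A word x of weight t is at distance k - t from a word c of weight k exactly
   when c extends x.  A nonzero letter is the same thing as a pair (column,
   symbol): the group words contain the pairs of letters in a common column,
   and, by the array property, each pair of letters in distinct columns lies in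
   exactly one row word.  Hence two codewords share at most one letter, and both
   may in addition be nonzero, with different letters, at the last coordinate;
   so their distance is at least 2k - 3, with equality for two rows that agree
   in the first column and differ in the last one. *)

Set Implicit Arguments.
Unset Strict Implicit.
Unset Printing Implicit Defensive.
Import GRing.Theory.

(** * Distance, weight and extension of words *)

(** Counted coordinate by coordinate: each side gets 2 where both letters are nonzero (equal or
    not), 1 where just one is, and 0 elsewhere. *)
Lemma hdistE (N : nat) (q : 'I_N -> nat) (x y : word q) :
  hdist x y + #|[set i | (x i != 0%R) && (y i != 0%R)]|
    + #|[set i | (x i != 0%R) && (y i == x i)]| = weight x + weight y.
Proof.
rewrite /hdist /weight !cardsE -!sum1_card.
rewrite !(big_mkcond (fun i => i \in _)) -!big_split /=; apply: eq_bigr => i _.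
rewrite !unfold_in /= (eq_sym (x i) (y i)).
have [->|neq_yx] := eqVneq (y i) (x i); first by case: eqP.
have [x0|_] := eqVneq (x i) 0%R; first by rewrite -x0 neq_yx.
by case: eqP.
Qed.

(** By [hdistE], distance [k - t] amounts to [#|B| + #|E| = 2 * t]; both sets lie in the support of
    [x], of size [t], so both must fill it. *)
Lemma hdist_sub (t k N : nat) (q : 'I_N -> nat) (x c : word q) :
  t <= k -> weight x = t -> weight c = k ->
  hdist x c = k - t <-> (forall l, x l != 0%R -> c l = x l).
Proof.
move=> le_tk wx wc; have eq_d := hdistE x c.
set B := [set i | _ && (c i != _)] in eq_d.
set E := [set i | _ && (c i == _)] in eq_d.
have sBx : B \subset [set i | x i != 0%R].
  by apply/subsetP => i; rewrite !inE => /andP[].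
have sEx : E \subset [set i | x i != 0%R].
  by apply/subsetP => i; rewrite !inE => /andP[].
have leB : #|B| <= weight x by exact: subset_leq_card.
have leE : #|E| <= weight x by exact: subset_leq_card.
split=> [d_xc l xl | c_x].
  have /eqP : #|E| = weight x by lia.
  move=> /eqP cE; have /eqP defE : E == [set i | x i != 0%R].
    by rewrite eqEcard sEx -/(weight x) cE leqnn.
  have : l \in E by rewrite defE inE.
  by rewrite inE => /andP[_ /eqP].
have EB : B = E.
  by apply/setP => i; rewrite !inE; case: eqP => //= /eqP xi; rewrite c_x ?eqxx.
have Ex : E = [set i | x i != 0%R].
  by apply/setP => i; rewrite !inE; case: eqP => //= /eqP xi; rewrite c_x ?eqxx.
have cE : #|E| = weight x by rewrite Ex.
rewrite EB in eq_d; lia.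
Qed.

(** * Nonzero letters as pairs (column, symbol) *)

Section Letters.

Variables r k : nat.
Hypothesis k_gt0 : 0 < k.

Notation q := (binary_plus (r * k) k.+1).
Notation coord := 'I_(r * k).+1.

Lemma binary_plus_gt1 (l : coord) : 1 < q l.
Proof. by rewrite /binary_plus; case: ifP. Qed.

Lemma letter_lt (l : coord) (v : 'Z_(q l)) : v < q l.
Proof. by have := ltn_ord v; rewrite [X in _ < X]Zp_cast // binary_plus_gt1. Qed.

Lemma letter_eqE (l : coord) (u v : 'Z_(q l)) : (u == v) = (u == v :> nat).
Proof. by []. Qed.

Lemma letter_eq0 (l : coord) (v : 'Z_(q l)) : (v == 0%R) = (v == 0 :> nat).
Proof. by []. Qed.

Lemma binary_letter (l : coord) (v : 'Z_(q l)) :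
  l < r * k -> v != 0%R -> v = 1 :> nat.
Proof.
move=> lt_l; rewrite letter_eq0; have := letter_lt v.
by rewrite {2}/binary_plus lt_l; case: (v : nat) => [|[]].
Qed.

Lemma last_coord (l : coord) : r * k <= l -> l = ord_max.
Proof. by move=> le_l; apply/val_inj/eqP; rewrite eqn_leq le_l -ltnS ltn_ord. Qed.

(* The last coordinate r * k also falls in its own column, number r. *)
Lemma col_subproof (l : coord) : l %/ k < r.+1.
Proof. by rewrite ltn_divLR // mulSn; have := ltn_ord l; lia. Qed.

Definition col (l : coord) : 'I_r.+1 := Ordinal (col_subproof l).

Lemma col_ltr (l : coord) : (col l < r) = (l < r * k).
Proof. by rewrite /= ltn_divLR. Qed.

(* The symbol of {0, ..., k-1} encoded by a nonzero letter v at coordinate l. *)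
Definition symbol (l : coord) (v : nat) : nat :=
  if l < r * k then l %% k else v.-1.

Lemma symbol_lt (l : coord) (v : 'Z_(q l)) : symbol l v < k.
Proof.
rewrite /symbol; case: ifPn => lt_l; first by rewrite ltn_mod.
have := letter_lt v; rewrite {2}/binary_plus (negPf lt_l); lia.
Qed.

Lemma group_wordE (i : 'I_r) (l : coord) :
  group_word k i l = (col l == i :> nat) :> nat.
Proof.
rewrite ffunE /=.
have -> : (l %/ k == i) = (i * k <= l < i * k + k).
  by rewrite eqn_leq -ltnS ltn_divLR // leq_divRL // mulSn addnC andbC.
by case: ifP.
Qed.

Lemma group_word_letter (i : 'I_r) (l : coord) (v : 'Z_(q l)) :
  v != 0%R -> (group_word k i l == v) = (col l == i :> nat).
Proof.
move=> nz_v; rewrite letter_eqE group_wordE.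
case: (ltnP l (r * k)) => lt_l.
  by rewrite (binary_letter lt_l nz_v) eqb1.
(* At the last coordinate the group word is zero while [v] is not, and the column is [r], beyond
   every [i]. *)
have /negPf -> : col l != i :> nat.
  by move: lt_l (ltn_ord i); rewrite leqNgt -col_ltr; lia.
by rewrite eq_sym; apply: negPf.
Qed.

Lemma row_wordE (j : 'I_r.+1 -> 'I_k) (l : coord) :
  row_word j l =
    (if l < r * k then (j (col l) == l %% k :> nat) : nat
     else (j ord_max).+1) :> nat.
Proof.
rewrite ffunE; case: ifPn => lt_l; last first.
  rewrite val_Zp_nat ?binary_plus_gt1 // /binary_plus (negPf lt_l) modn_small //.
  by rewrite ltnS.
set b := [exists i, _]; suff -> : (j (col l) == l %% k :> nat) = b by case: b.
apply/eqP/existsP => [jl | [i /eqP l_i]].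
  have lt_col : l %/ k < r by rewrite ltn_divLR.
  exists (Ordinal lt_col).
  have -> : widen_ord (leqnSn r) (Ordinal lt_col) = col l by exact: val_inj.
  by rewrite /= jl -divn_eq.
have -> : col l = widen_ord (leqnSn r) i.
  by apply: val_inj; rewrite /= l_i divnMDl // divn_small ?addn0.
by rewrite l_i modnMDl modn_small.
Qed.

Lemma row_word_letter (j : 'I_r.+1 -> 'I_k) (l : coord) (v : 'Z_(q l)) :
  v != 0%R -> (row_word j l == v) = (j (col l) == symbol l v :> nat).
Proof.
move=> nz_v; rewrite letter_eqE row_wordE /symbol.
case: (ltnP l (r * k)) => lt_l.
  by rewrite (binary_letter lt_l nz_v) eqb1.
have -> : col l = ord_max.
  by apply: val_inj; rewrite (last_coord lt_l) /= mulnK.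
by move: nz_v; rewrite letter_eq0 /=; case: (v : nat).
Qed.

Lemma weight_group (i : 'I_r) : weight (group_word k i) = k.
Proof.
have pos_lt (a : 'I_k) : i * k + a < (r * k).+1.
  have : i.+1 * k <= r * k by rewrite leq_mul2r ltn_ord orbT.
  by rewrite mulSn; have := ltn_ord a; lia.
pose pos a := Ordinal (pos_lt a).
have pos_inj : injective pos.
  by move=> a b /(congr1 val) /= /addnI /val_inj.
rewrite -[RHS]card_ord -(card_imset predT pos_inj) /weight.
apply: eq_card => l; rewrite inE letter_eq0 group_wordE eqb0 negbK.
apply/eqP/imsetP => [/= col_l | [a _ ->]]; last first.
  by rewrite /= divnMDl // divn_small ?addn0.
exists (Ordinal (ltn_pmod l k_gt0)) => //.
by apply: val_inj; rewrite /= -col_l -divn_eq.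
Qed.

Lemma row_pos_subproof (j : 'I_r.+1 -> 'I_k) (i : 'I_r.+1) :
  (if i < r then i * k + j i else r * k) < (r * k).+1.
Proof.
case: ifP => // lt_i; have : i.+1 * k <= r * k by rewrite leq_mul2r lt_i orbT.
by rewrite mulSn; have := ltn_ord (j i); lia.
Qed.

(** The support of [row_word j], parametrized by the columns; the last column offers only the
    coordinate [r * k]. *)
Definition row_pos j i : coord := Ordinal (row_pos_subproof j i).

Lemma col_row_pos j : cancel (row_pos j) col.
Proof.
move=> i; apply: val_inj => /=; case: ifPn => lt_i.
  by rewrite divnMDl // divn_small ?addn0.
by rewrite mulnK //; have := ltn_ord i; lia.
Qed.

Lemma row_word_neq0 (j : 'I_r.+1 -> 'I_k) (l : coord) :
  (row_word j l != 0%R) = (l == row_pos j (col l)).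
Proof.
rewrite letter_eq0 row_wordE -val_eqE /= -col_ltr /=; case: ifPn => lt_l.
  by rewrite eqb0 negbK {2}(divn_eq l k) eqn_add2l eq_sym.
by rewrite (@last_coord l) //= ?eqxx // leqNgt -col_ltr.
Qed.

Lemma weight_row (j : 'I_r.+1 -> 'I_k) : weight (row_word j) = r.+1.
Proof.
rewrite -[RHS]card_ord -(card_imset predT (can_inj (col_row_pos j))) /weight.
apply: eq_card => l; rewrite inE row_word_neq0.
apply/eqP/imsetP => [-> | [i _ ->]]; first by exists (col l).
by rewrite col_row_pos.
Qed.

(* Nonzero binary letters are equal, so only at the last coordinate can two
   words both be nonzero and yet differ. *)
Lemma hdist_binary_plus (x y : word q) :
  #|[set l | (x l != 0%R) && (y l == x l)]| <= 1 ->
  weight x + weight y <= hdist x y + 3.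
Proof.
have := hdistE x y; set B := [set l | _ && (y l != _)]; set E := [set l | _].
have : B \subset ord_max |: E.
  apply/subsetP => l; rewrite !inE => /andP[xl yl].
  case: (ltnP l (r * k)) => [lt_l|/last_coord ->]; last by rewrite eqxx.
  by rewrite xl letter_eqE (binary_letter lt_l xl) (binary_letter lt_l yl) orbT.
(* The 3 arises as [#|B| + #|E|], with [#|E| <= 1] and [#|B| <= 1 + #|E|]. *)
move=> /subset_leq_card; rewrite cardsU1; case: (_ \notin _); lia.
Qed.

End Letters.

(** * Pairs of letters in codewords and in rows *)

(** Two shared letters would form a word of weight 2 extended by both codewords, against
    uniqueness. *)
Lemma steiner_pair_agree (k N : nat) (q : 'I_N -> nat) (C : {set word q}) :
  1 < k -> (forall c, c \in C -> weight c = k) ->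
  (forall x : word q, weight x = 2 ->
     exists! c : word q, c \in C /\ hdist x c = k - 2) ->
  forall c c', c \in C -> c' \in C -> c != c' ->
    #|[set l | (c l != 0%R) && (c' l == c l)]| <= 1.
Proof.
move=> k_gt1 wC uC c c' Cc Cc' neq_c; rewrite leqNgt; apply/negP.
set E := [set l | _] => /card_gt1P[l [l' [El El' neq_l]]].
pose x : word q := [ffun m => if m \in [set l; l'] then c m else 0%R].
have supp_x : [set m | x m != 0%R] = [set l; l'].
  apply/setP => m; rewrite inE ffunE; case: ifP => [|_]; last by rewrite eqxx.
  by case/set2P => ->; [move: El | move: El']; rewrite inE => /andP[->].
have wx : weight x = 2 by rewrite /weight supp_x cards2 neq_l.
have x_in (d : word q) : d \in C -> d l = c l -> d l' = c l' ->
    hdist x d = k - 2.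
  move=> Cd dl dl'; apply/(hdist_sub k_gt1 wx (wC _ Cd)) => m.
  have -> : (x m != 0%R) = (m \in [set l; l']) by rewrite -supp_x inE.
  by rewrite ffunE => mE; rewrite mE; case/set2P: mE => ->.
have [d [_ ud]] := uC x wx; case/eqP: neq_c.
rewrite -(ud c) ?(ud c') //; split=> //; apply: x_in => //.
  by move: El; rewrite inE => /andP[_ /eqP].
by move: El'; rewrite inE => /andP[_ /eqP].
Qed.

(** The counting condition turned into unique existence, with symbols as natural numbers to fit
    [symbol]. *)
Lemma oa_row (n k : nat) (A : 'M['I_k]_(k ^ 2, n)) (c1 c2 : 'I_n) (a b : nat) :
  orthogonal_array2 A -> c1 != c2 -> a < k -> b < k ->
  exists i, [/\ A i c1 = a :> nat, A i c2 = b :> nat &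
    forall i', A i' c1 = a :> nat -> A i' c2 = b :> nat -> i' = i].
Proof.
move=> hA neq_c lt_a lt_b.
have /eqP/cards1P[i defi] := hA _ _ neq_c (Ordinal lt_a) (Ordinal lt_b).
have : i \in [set i] by rewrite inE.
rewrite -defi inE => /andP[/eqP Aa /eqP Ab].
exists i; split=> [||i' Aa' Ab']; rewrite ?Aa ?Ab //.
apply/set1P; rewrite -defi inE.
by apply/andP; split; apply/eqP/val_inj.
Qed.

(* n = r.+1 is the number of columns of the array *)
Theorem theorem14 (r k : nat) (hr : 1 <= r) (hnk : r.+1 = k)
  (A : 'M['I_k]_(k ^ 2, r.+1)) (hA : orthogonal_array2 A) :
  mixed_steiner_system 2 k (oa_system A).
Proof.
have k_gt1 : 1 < k by rewrite -hnk.
have k_gt0 : 0 < k by exact: ltnW.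
have wC c : c \in oa_system A -> weight c = k.
  by case/setUP => /imsetP[i _ ->]; rewrite ?weight_group ?weight_row.
have uC x : weight x = 2 ->
    exists! c, c \in oa_system A /\ hdist x c = k - 2.
  move=> wx.
  have /eqP/cards2P[l [l' [neq_l defx]]] := wx.
  have xl : x l != 0%R.
    by have : l \in [set l; l']; [rewrite set21 | rewrite -defx inE].
  have xl' : x l' != 0%R.
    by have : l' \in [set l; l']; [rewrite set22 | rewrite -defx inE].
  have distP c : c \in oa_system A ->
      hdist x c = k - 2 <-> (c l == x l) && (c l' == x l').
    move=> Cc; rewrite (hdist_sub k_gt1 wx (wC _ Cc)).
    split=> [c_x|/andP[/eqP cl /eqP cl'] m xm]; first by rewrite !c_x ?eqxx.
    have : m \in [set l; l'] by rewrite -defx inE.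
    by case/set2P => ->.
  have [eq_col|neq_col] := eqVneq (col k_gt0 l) (col k_gt0 l').
    (* Column [r] holds a single coordinate, so two distinct coordinates in a common column are
       binary. *)
    have lt_l : l < r * k.
      rewrite ltnNge; apply: contra neq_l => le_l; apply/eqP.
      have le_l' : r * k <= l'.
        by rewrite leqNgt -(col_ltr k_gt0) -eq_col col_ltr -leqNgt.
      by rewrite [l](last_coord le_l) [l'](last_coord le_l').
    have lt_col : col k_gt0 l < r by rewrite col_ltr.
    have lt_l' : l' < r * k by rewrite -(col_ltr k_gt0) -eq_col.
    exists (group_word k (Ordinal lt_col)); split.
      have Cg : group_word k (Ordinal lt_col) \in oa_system A.
        by rewrite inE imset_f.
      split=> //; apply/distP => //.
      by rewrite !(group_word_letter k_gt0) // -eq_col eqxx.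
    move=> c [Cc /(distP _ Cc)]; case/setUP: Cc => /imsetP[i _ ->].
      rewrite !(group_word_letter k_gt0) // => /andP[/eqP col_i _].
      by congr group_word; apply: val_inj.
    (* A row word has only one letter per column, so it cannot contain both. *)
    rewrite !(row_word_letter k_gt0) // -eq_col /symbol lt_l lt_l'.
    case/andP => /eqP-> /eqP eq_mod; case/eqP: neq_l; apply: val_inj.
    have /= eq_div := congr1 val eq_col.
    by rewrite /= (divn_eq l k) (divn_eq l' k) eq_div eq_mod.
  (* Letters in distinct columns: the array supplies the row, and a group word stays within one
     column. *)
  have [i [Ai Ai' ui]] := oa_row hA neq_col
    (symbol_lt k_gt0 (x l)) (symbol_lt k_gt0 (x l')).
  exists (row_word (A i)); split.
    have Cr : row_word (A i) \in oa_system A by rewrite inE orbC imset_f.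
    split=> //; apply/distP => //.
    by rewrite !(row_word_letter k_gt0) // Ai Ai' !eqxx.
  move=> c [Cc /(distP _ Cc)]; case/setUP: Cc => /imsetP[i' _ ->].
    rewrite !(group_word_letter k_gt0) // => /andP[/eqP col_i /eqP col_i'].
    by case/eqP: neq_col; apply/val_inj/(etrans col_i (esym col_i')).
  rewrite !(row_word_letter k_gt0) // => /andP[/eqP Aa /eqP Ab].
  by rewrite (ui i').
have min_dist c c' : c \in oa_system A -> c' \in oa_system A -> c != c' ->
    2 * (k - 2) + 1 <= hdist c c'.
  move=> Cc Cc' /(steiner_pair_agree k_gt1 wC uC Cc Cc')/hdist_binary_plus.
  (* The bound [2 * k <= hdist c c' + 3] is the claim, as [2 * (k - 2) + 1 = 2 * k - 3]. *)
  rewrite !wC //; lia.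
split=> //; split=> //.
have neq_0m : (ord0 : 'I_r.+1) != ord_max by rewrite -val_eqE /= eq_sym -lt0n.
(* Witnesses for equality: two rows with symbol 0 in the first column and symbols 0 and 1 in the
   last. *)
have [i [Ai0 Aim _]] := oa_row hA neq_0m k_gt0 k_gt0.
have [i' [Ai'0 Ai'm _]] := oa_row hA neq_0m k_gt0 k_gt1.
have Cr a : row_word (A a) \in oa_system A by rewrite inE orbC imset_f.
have last_row a : row_word (A a) ord_max = (A a ord_max).+1 :> nat.
  by rewrite (row_wordE k_gt0) /= ltnn.
have neq_last : row_word (A i) ord_max != row_word (A i') ord_max.
  by rewrite letter_eqE !last_row Aim Ai'm.
have neq_row : row_word (A i) != row_word (A i').
  by apply: contraNneq neq_last => ->.
exists (row_word (A i)), (row_word (A i')); split=> //.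
apply/eqP; rewrite eqn_leq min_dist // andbT.
(* It remains to see that [#|B| + #|E| >= 3]: the words agree at [l0], and both are nonzero at [l0]
   and at the last coordinate. *)
have := hdistE (row_word (A i)) (row_word (A i')); rewrite !wC //.
set B := [set l | _ && (_ != _)]; set E := [set l | _].
pose l0 : 'I_(r * k).+1 := ord0.
have l0_lt : l0 < r * k by rewrite muln_gt0 hr.
have row0 a : A a ord0 = 0 :> nat -> row_word (A a) l0 = 1 :> nat.
  move=> Aa; rewrite (row_wordE k_gt0) l0_lt.
  have -> : col k_gt0 l0 = ord0 by apply: val_inj; rewrite /= div0n.
  by rewrite Aa mod0n.
have E0 : l0 \in E.
  by rewrite inE letter_eq0 letter_eqE !row0.
have B2 : [set l0; ord_max] \subset B.
  apply/subsetP => l /set2P[] ->; rewrite inE !letter_eq0.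
    by rewrite !row0.
  by rewrite !last_row.
have neq_l0 : l0 != ord_max by rewrite -val_eqE /= eq_sym -lt0n.
have := subset_leq_card B2; rewrite cards2 neq_l0.
have : 0 < #|E| by apply/card_gt0P; exists l0.
lia.
Qed.
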